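(* Let $0<q<1$ and let $f(t)$, $t>0$, be a $q$-density of a random variable $X$ possessing finite $q$-moments of all orders. If there is a positive constant $C$ such that $$f(q^{-j})\geqslant C\, q^{j(j+1)/2}\quad\text{for all integers } j\geqslant 0,$$ then the distribution of $X$ is $q$-moment indeterminate.
   Context: Throughout $0<q<1$. $q$-integrals (Jackson): $\int_0^{x} f(t)\,d_qt=x(1-q)\sum_{j=0}^\infty f(xq^j)q^j$ for $x>0$, and $\int_0^{\infty} f(t)\,d_qt=(1-q)\sum_{j=-\infty}^\infty f(q^j)q^j$. A function $f(t)$, $t>0$, is a $q$-density of a random variable $X$ if the distribution function $F_X$ of $X$ satisfies $F_X(x)=\int_0^x f(t)\,d_qt$ for all $x>0$. (All $q$-densities are non-negative on $(0,\infty)$ and satisfy $\int_0^\infty f(t)\,d_qt=1$.) The $k$-th order $q$-moment of a random variable $X$ with $q$-density $f$ is $m_q(k;X)=\int_0^\infty t^k f(t)\,d_qt$, $k\in\mathbb{N}_0=\{0,1,2,\dots\}$. Two functions $f,g$ on $(0,\infty)$ are equivalent, $f\sim g$, if $f(q^j)=g(q^j)$ for all $j\in\mathbb{Z}$. Let $X$ have $q$-density $f_X$ and finite $q$-moments of all orders. The distribution $P_X$ of $X$ is $q$-moment determinate if, for every random variable $Y$ with a $q$-density $f_Y$, the equalities $m_q(k;X)=m_q(k;Y)$ for all $k\in\mathbb{N}_0$ imply $f_X\sim f_Y$. Otherwise $P_X$ is $q$-moment indeterminate. *)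

(* Defs.v *)
From HB Require Import structures.
From mathcomp Require Import all_boot all_order all_algebra.
From mathcomp Require Import all_classical all_reals all_analysis.

Set Implicit Arguments.
Unset Strict Implicit.
Unset Printing Implicit Defensive.

Import Order.TTheory GRing.Theory Num.Theory.
Import numFieldNormedType.Exports.

Local Open Scope classical_set_scope.
Local Open Scope ring_scope.

(* Functions on (0, +oo) are represented by functions on R; only their values
   at positive arguments are ever used. *)

Section q_calculus.
Context {R : realType}.
Implicit Types (q x : R) (f g : R -> R).

(* The limit operator [\sum_(0 <= j <oo)] is total, with an arbitrary value on
   divergent series: [q_density] below requires convergence explicitly. *)
Definition q_integral0 q f x : \bar R :=
  ((x * (1 - q))%:E * \sum_(0 <= j <oo) (f (x * q ^+ j) * q ^+ j)%:E)%E.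

(* The sum over all integers j, split into j >= 0 and j <= -1. It is only
   applied to functions that are nonnegative on (0, +oo), so both halves have a
   limit in [0, +oo], which is +oo when the integral diverges. *)
Definition q_integral0y q f : \bar R :=
  ((1 - q)%:E * (\sum_(0 <= j <oo) (f (q ^+ j) * q ^+ j)%:E +
                 \sum_(1 <= j <oo) (f (q ^- j) * q ^- j)%:E))%E.

Definition q_density q d (T : measurableType d) (P : probability T R)
    (X : {RV P >-> R}) f : Prop :=
  forall x, 0 < x ->
    cvgn (series (fun j => f (x * q ^+ j) * q ^+ j)) /\
    cdf X x = q_integral0 q f x.

Definition q_moment q f (k : nat) : \bar R :=
  q_integral0y q (fun t => t ^+ k * f t).

Definition finite_q_moments q f : Prop :=
  forall k, q_moment q f k \is a fin_num.

Definition q_equiv q f g : Prop := forall j : int, f (q ^ j) = g (q ^ j).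

(* The density f is determined by X at every x > 0, because
   F_X(x) - F_X(q x) = x (1 - q) f(x); quantifying over it therefore makes this
   a property of the distribution of X alone. It is meant for X having a
   q-density with finite q-moments. *)
Definition q_moment_determinate q d (T : measurableType d)
    (P : probability T R) (X : {RV P >-> R}) : Prop :=
  forall f, q_density q X f -> finite_q_moments q f ->
  forall d' (T' : measurableType d') (P' : probability T' R)
    (Y : {RV P' >-> R}) g, q_density q Y g ->
  (forall k, q_moment q f k = q_moment q g k) -> q_equiv q f g.

Definition q_moment_indeterminate q d (T : measurableType d)
    (P : probability T R) (X : {RV P >-> R}) : Prop :=
  ~ q_moment_determinate q X.

End q_calculus.

(* Main.v *)
(** With (q;q)_n = (1 - q) ... (1 - q^n), put
    a_n = (-1)^n q^(n(n-1)/2) / (q;q)_n ([euler_coef]). By Euler's identity the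
    entire function sum_n a_n z^n = prod_i (1 - z q^i) vanishes at z = q^(-k)
    for every k >= 0. Let h(q^(-n)) = e a_n q^n for n >= 0 and h(q^n) = 0 for
    n > 0. All q-moments of h vanish, and |a_n| q^n = O(q^(n(n+1)/2)), so the
    lower bound on f makes f + h nonnegative on the powers of q when e > 0 is
    small. The law putting mass (1 - q) q^j (f + h)(q^j) at each q^j then has a
    q-density which agrees with f + h on the powers of q: it has the q-moments
    of f, but differs from f at 1. *)
From HB Require Import structures.
Require Import Defs.
From mathcomp Require Import all_boot all_order all_algebra.
From mathcomp Require Import all_classical all_reals all_analysis ring lra zify.
Import Order.TTheory GRing.Theory Num.Theory.
Import numFieldNormedType.Exports.
Local Open Scope classical_set_scope.
Local Open Scope ring_scope.

(** * Zeros of the Euler series at the points q^(-k), k >= 0 *)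

Section euler_coefficients.
Context {R : realType} (q : R).
Hypotheses (q0 : 0 < q) (q1 : q < 1).

Definition euler_coef (n : nat) : R :=
  (-1) ^+ n * q ^+ 'C(n, 2) / \prod_(i < n) (1 - q ^+ i.+1).

Lemma euler_coef0 : euler_coef 0 = 1.
Proof. by rewrite /euler_coef big_ord0 !expr0 mulr1 divr1. Qed.

Lemma onem_expr_gt0 n : 0 < 1 - q ^+ n.+1.
Proof. by rewrite subr_gt0 exprn_ilt1 ?ltW. Qed.

(** This compares the coefficients of z^(n+1) in S(z) = (1 - z) S(q z). *)
Lemma euler_coefS n :
  (1 - q ^+ n.+1) * euler_coef n.+1 = - (q ^+ n * euler_coef n).
Proof.
rewrite /euler_coef big_ord_recr/= binS bin1 exprD (exprS (-1)).
have /lt0r_neq0 := onem_expr_gt0 n; set u := 1 - _ => u0.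
have : \prod_(i < n) (1 - q ^+ i.+1) != 0.
  by apply/lt0r_neq0/prodr_gt0 => i _; exact: onem_expr_gt0.
by set p := \prod_(_ < _) _ => p0; field; rewrite p0 u0.
Qed.

(* A truncated form of S(z) = (1 - z) S(q z) for S(z) = sum_n a_n z^n, which
   gives S(1) = 0 and then S(q^(-k)) = 0 by induction on k. *)
Lemma euler_partial_sum (z : R) N :
  \sum_(0 <= n < N) euler_coef n * z ^+ n =
  (1 - z) * \sum_(0 <= n < N) euler_coef n * (q * z) ^+ n
    - (1 - q ^+ N) * euler_coef N * z ^+ N.
Proof.
elim: N => [|N ih]; first by rewrite !big_geq// expr0; ring.
by rewrite !big_nat_recr//= ih euler_coefS exprMn exprS; ring.
Qed.

(* Uses 1 / (1 - q^(n+1)) <= 1 + q^n / (1 - q) <= exp (q^n / (1 - q)). *)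
Lemma prod_onem_expr_le n :
  (\prod_(i < n) (1 - q ^+ i.+1))^-1 <= expR ((1 - q ^+ n) / (1 - q) ^+ 2).
Proof.
elim: n => [|n ih]; first by rewrite big_ord0 invr1 expr0 subrr mul0r expR0.
have h : 0 < 1 - q by rewrite subr_gt0.
have hn := onem_expr_gt0 n.
rewrite big_ord_recr/= invfM.
(* The exponent is the geometric sum of the q^i / (1 - q) over i < n. *)
have -> : (1 - q ^+ n.+1) / (1 - q) ^+ 2 =
    (1 - q ^+ n) / (1 - q) ^+ 2 + q ^+ n / (1 - q).
  by rewrite exprS; field; exact: lt0r_neq0.
rewrite expRD ler_pM ?invr_ge0 ?(ltW hn)//.
  by apply: prodr_ge0 => i _; exact/ltW/onem_expr_gt0.
apply: le_trans (expR_ge1Dx _).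
rewrite -[X in _ <= X](mulfK (lt0r_neq0 hn)) -[X in X <= _]mul1r.
rewrite ler_pM2r ?invr_gt0//.
have qn1 : q ^+ n * q <= q by rewrite ler_piMl// ?exprn_ile1 ?ltW.
have qn0 : 0 < q ^+ n by rewrite exprn_gt0.
have e : q ^+ n <= q ^+ n / (1 - q) * (1 - q ^+ n.+1).
  by rewrite mulrAC ler_pdivlMr// ler_pM2l// lerB// exprS mulrC.
rewrite mulrDl mul1r; move: e; rewrite exprS; nra.
Qed.

(** Bounds 1 / (q;q)_n uniformly in n: the term q^n is dropped from the exponent in
    [prod_onem_expr_le]. *)
Definition euler_bound : R := expR (1 / (1 - q) ^+ 2).

Lemma euler_coef_le n : `|euler_coef n| <= euler_bound * q ^+ 'C(n, 2).
Proof.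
rewrite /euler_coef !normrM normrX normrN1 expr1n mul1r normrX (gtr0_norm q0).
rewrite mulrC ler_wpM2r ?exprn_ge0 ?(ltW q0)// ger0_norm; last first.
  by rewrite invr_ge0; apply: prodr_ge0 => i _; exact/ltW/onem_expr_gt0.
apply: (le_trans (prod_onem_expr_le n)).
rewrite ler_expR ler_wpM2r ?invr_ge0 ?sqr_ge0//.
by rewrite gerBl exprn_ge0 ?ltW.
Qed.

(** The quadratic exponent of q in a_n outweighs the linear growth of the exponent in q^(-k n). *)
Lemma cvg_euler_coefM0 k :
  euler_coef n * (q ^- k) ^+ n @[n --> \oo] --> 0.
Proof.
apply: norm_cvg0.
apply: (@squeeze_cvgr _ _ _ _ (fun=> 0) (fun n => euler_bound * q ^+ n)).
- near=> n; rewrite normr_ge0/= normrM.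
  apply: (le_trans (ler_wpM2r (normr_ge0 _) (euler_coef_le n))).
  rewrite -mulrA ler_wpM2l ?expR_ge0//.
  rewrite ger0_norm ?exprn_ge0 ?invr_ge0 ?exprn_ge0 ?(ltW q0)//.
  rewrite exprVn -exprM ler_pdivrMr ?exprn_gt0// -exprD.
  rewrite ler_wiXn2l ?(ltW q0) ?(ltW q1)//.
  (* From this rank on, n (n - 1) / 2 >= n + k n. *)
  have : (k.*2 + 3 <= n)%N by near: n; exact: nbhs_infty_ge.
  by rewrite bin2 -divn2 => kn; rewrite leq_divRL//; nia.
- exact: cvg_cst.
- by apply: cvg_geometric; rewrite gtr0_norm.
Unshelve. all: by end_near. Qed.

Lemma euler_sum0 k :
  \sum_(0 <= n < N) euler_coef n * (q ^- k) ^+ n @[N --> \oo] --> 0.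
Proof.
(* The correction term of [euler_partial_sum] at z = q^(-j) disappears in the limit. *)
have rem j :
    (1 - q ^+ N) * euler_coef N * (q ^- j) ^+ N @[N --> \oo] --> 0.
  have qN : q ^+ N @[N --> \oo] --> 0.
    by apply: cvg_expr; rewrite gtr0_norm.
  have uqN : 1 - q ^+ N @[N --> \oo] --> (1 - 0 : R).
    by apply: cvgB qN; exact: cvg_cst.
  rewrite -(mulr0 (1 - 0)); under eq_fun do rewrite -mulrA.
  exact: cvgM uqN (cvg_euler_coefM0 j).
have step j l :
    \sum_(0 <= n < N) euler_coef n * (q * q ^- j) ^+ n @[N --> \oo] --> l ->
    \sum_(0 <= n < N) euler_coef n * (q ^- j) ^+ n @[N --> \oo]
       --> (1 - q ^- j) * l.
  move=> cvl; under eq_fun do rewrite euler_partial_sum.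
  rewrite -[_ * l]subr0; apply: cvgB (rem j); exact: cvgMl_tmp.
elim: k => [|k ih].
  under eq_fun do rewrite euler_partial_sum invr1 subrr mul0r.
  under eq_fun do rewrite sub0r.
  by rewrite -oppr0; apply: cvgN; have := rem 0%N; rewrite invr1.
have := step k.+1 0; rewrite mulr0; apply.
by rewrite exprS invfM mulrA divff ?mul1r ?lt0r_neq0.
Qed.

End euler_coefficients.

(** * Random variables whose q-density has prescribed values on the powers of q *)

(* The partial sums of the q-integral of this function telescope to
   F(x) - F(x q^N), and F(x q^N) tends to F(0) = 0 by right continuity. *)
Lemma q_density_of_cdf {R : realType} (q : R) (q0 : 0 < q) (q1 : q < 1)
    d (T : measurableType d) (P : probability T R) (Y : {RV P >-> R}) :
  cdf Y 0 = 0%E ->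
  q_density q Y
    (fun x => (fine (cdf Y x) - fine (cdf Y (q * x))) / (x * (1 - q))).
Proof.
move=> Y0 x x0; pose F r := fine (cdf Y r).
have FE r : cdf Y r = (F r)%:E by rewrite fineK ?fin_num_measure.
have q1' : 1 - q != 0 by rewrite lt0r_neq0// subr_gt0.
set u := fun j => _.
have uE N : series u N = (F x - F (x * q ^+ N)) / (x * (1 - q)).
  rewrite seriesEnat/=; elim: N => [|N ih].
    by rewrite big_geq// expr0 mulr1 subrr mul0r.
  rewrite big_nat_recr//= ih /u -/(F _) -/(F _).
  rewrite (_ : q * (x * q ^+ N) = x * q ^+ N.+1); last by rewrite exprS; ring.
  have qN : q ^+ N != 0 by rewrite expf_neq0// lt0r_neq0.
  by field; rewrite qN q1' lt0r_neq0.
have F0 : F (x * q ^+ N) @[N --> \oo] --> (0 : R).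
  have := @cdf_right_continuous _ _ _ _ Y 0; rewrite Y0 => /cvge_at_rightP h.
  have /fine_cvg : cdf Y (x * q ^+ N) @[N --> \oo] --> 0%:E.
    apply: h; split; first by move=> n; rewrite mulr_gt0// exprn_gt0.
    by apply: cvg_geometric; rewrite gtr0_norm.
  exact.
have cu : series u @ \oo --> F x / (x * (1 - q)).
  rewrite -[F x]subr0; rewrite (funext uE).
  by apply: cvgMr_tmp; apply: cvgB F0; exact: cvg_cst.
split; first by apply/cvg_ex; eexists; exact: cu.
rewrite /q_integral0 (_ : limn _ = (F x / (x * (1 - q)))%:E); last first.
  apply/cvg_lim => //; under eq_fun do rewrite sumEFin.
  by apply: cvg_EFin => //; near=> n.
rewrite FE -EFinM; congr EFin; field.
by rewrite q1' lt0r_neq0.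
Unshelve. all: by end_near. Qed.

Lemma eseries_unique_term {R : realType} (u : nat -> \bar R) (N m : nat) :
  (N <= m)%N -> (forall n, (N <= n)%N -> n != m -> u n = 0%E) ->
  (\sum_(N <= n <oo) u n = u m)%E.
Proof.
move=> Nm u0; apply: lim_near_cst => //; near=> n.
rewrite (bigD1_seq m)/= ?iota_uniq//; last first.
  by rewrite mem_index_iota Nm; near: n; exact: nbhs_infty_gt.
rewrite big_nat_cond big1 ?adde0// => i /andP[/andP[Ni _]]; exact: u0.
Unshelve. all: by end_near. Qed.

Section discrete_law.
Context {R : realType} (x : int -> R) (w : int -> R).
Hypothesis w_ge0 : forall j, 0 <= w j.
Local Open Scope ereal_scope.

Let atom j : {measure set (measurableTypeR R) -> \bar R} :=
  mscale (NngNum (w_ge0 j)) \d_(x j : measurableTypeR R).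

(** The sum over all integers is split as in [q_integral0y]; the second series starts at 1 so that
    the atom of index 0 is counted once. *)
Definition discrete_law : set (measurableTypeR R) -> \bar R :=
  measure_add (mseries (fun n : nat => atom n) 0)
              (mseries (fun n : nat => atom (- n%:Z)%R) 1).

HB.instance Definition _ := Measure.on discrete_law.

Lemma discrete_lawE (A : set R) : discrete_law A =
  \sum_(0 <= n <oo) (w n)%:E * (x n \in A)%:R%:E +
  \sum_(1 <= n <oo) (w (- n%:Z))%:E * (x (- n%:Z) \in A)%:R%:E.
Proof. by rewrite /discrete_law measure_addE /mseries. Qed.

Lemma discrete_law0 (A : set R) : (forall j, ~ A (x j)) -> discrete_law A = 0.
Proof.
move=> xA; rewrite discrete_lawE !eseries0 ?adde0// => n _ _;
  by rewrite memNset ?mule0.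
Qed.

Lemma discrete_law1 (A : set R) j : A (x j) -> (forall i, A (x i) -> i = j) ->
  discrete_law A = (w j)%:E.
Proof.
move=> Aj jA; rewrite discrete_lawE.
have xA i : i != j -> (w i)%:E * (x i \in A)%:R%:E = 0.
  by move=> /eqP ij; rewrite memNset ?mule0// => /jA.
have xj : (w j)%:E * (x j \in A)%:R%:E = (w j)%:E by rewrite mem_set// mule1.
case: j => m in Aj jA xA xj *.
  rewrite (@eseries_unique_term _ _ _ m)//; last by move=> n _ nm; apply: xA.
  by rewrite xj eseries0 ?adde0// => n n0 _; apply: xA; lia.
rewrite eseries0 ?add0e; last by move=> n _ _; apply: xA.
(* The index [Negz m] is -(m + 1), so its atom is the term m + 1 of the second series. *)
rewrite (@eseries_unique_term _ _ _ m.+1)//.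
by move=> n n0 nm; apply: xA; lia.
Qed.

Hypothesis w1 :
  \sum_(0 <= n <oo) (w n)%:E + \sum_(1 <= n <oo) (w (- n%:Z))%:E = 1.

Let discrete_law_setT : discrete_law setT = 1.
Proof.
rewrite discrete_lawE -[RHS]w1; congr (_ + _); apply: eq_eseriesr => n _;
  by rewrite in_setT mule1.
Qed.

HB.instance Definition _ :=
  Measure_isProbability.Build _ _ _ discrete_law discrete_law_setT.

Let idTR : measurableTypeR R -> R := idfun.

#[local] HB.instance Definition _ :=
  @isMeasurableFun.Build _ _ _ _ idTR (@measurable_id _ _ setT).

Definition discrete_RV : {RV discrete_law >-> R} := idTR.

Lemma cdf_discrete_RV r : cdf discrete_RV r = discrete_law `]-oo, r].
Proof. by rewrite /cdf/= /distribution /pushforward preimage_id. Qed.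

End discrete_law.

(** Integer exponents match the indexing of [q_equiv] and of the atoms of [discrete_law]. *)
Lemma q_integral0yE {R : realType} (q : R) (f : R -> R) :
  q_integral0y q f =
  ((1 - q)%:E * (\sum_(0 <= n <oo) (f (q ^ n%:Z) * q ^ n%:Z)%:E +
                 \sum_(1 <= n <oo) (f (q ^ (- n%:Z)) * q ^ (- n%:Z))%:E))%E.
Proof.
rewrite /q_integral0y; congr (_ * (_ + _))%E.
by apply: eq_eseriesr => n _; rewrite exprnN.
Qed.

Lemma eq_q_moment {R : realType} {q : R} {f g : R -> R} k :
  q_equiv q f g -> q_moment q f k = q_moment q g k.
Proof.
move=> fg; rewrite /q_moment !q_integral0yE; congr (_ * (_ + _))%E;
  by apply: eq_eseriesr => n _; rewrite fg.
Qed.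

(** The density supplied by [q_density_of_cdf], multiplied by (1 - q) q^j, is at q^j the mass of the
    interval ]q^(j+1), q^j]. The only atom there is q^j, of mass (1 - q) q^j f(q^j). *)
Lemma exists_q_density {R : realType} {q : R} {f : R -> R} :
  0 < q -> q < 1 ->
  (forall j : int, 0 <= f (q ^ j)) -> q_integral0y q f = 1%E ->
  exists d (T : measurableType d) (P : probability T R) (Y : {RV P >-> R})
    (g : R -> R), q_density q Y g /\ q_equiv q f g.
Proof.
move=> q0 q1 f0 f1; pose w (j : int) := (1 - q) * q ^ j * f (q ^ j).
have w0 j : 0 <= w j.
  by rewrite !mulr_ge0 ?exprz_ge0 ?(ltW q0)// subr_ge0 ltW.
have w1 :
    (\sum_(0 <= n <oo) (w n)%:E + \sum_(1 <= n <oo) (w (- n%:Z))%:E = 1)%E.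
  have t0 (j : int) : (0 <= (f (q ^ j) * q ^ j)%:E)%E.
    by rewrite lee_fin mulr_ge0 ?exprz_ge0 ?(ltW q0).
  rewrite -f1 q_integral0yE ge0_muleDr; [|exact: nneseries_ge0..].
  rewrite -nneseriesZl; last by move=> n _; exact: t0.
  rewrite -nneseriesZl; last by move=> n _; exact: t0.
  congr (_ + _)%E; apply: eq_eseriesr => n _;
    by rewrite -EFinM /w -mulrA [_ * f _]mulrC.
pose Y := discrete_RV (exprz q) w w0 w1.
exists _, _, _, Y; eexists; split.
  (* All atoms are positive, so the distribution function vanishes at 0. *)
  apply: q_density_of_cdf => //; rewrite cdf_discrete_RV discrete_law0// => j.
  by apply/negP; rewrite /= in_itv/= -ltNge exprz_gt0.
move=> j.
have qj : q ^ j != 0 by rewrite lt0r_neq0// exprz_gt0.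
have q1' : 1 - q != 0 by rewrite lt0r_neq0// subr_gt0.
apply: (mulfI (mulf_neq0 q1' qj)); rewrite -[LHS]/(w j); apply/esym.
transitivity (fine (cdf Y (q ^ j)) - fine (cdf Y (q * q ^ j))).
  by field; rewrite qj q1'.
have qle (a b : int) : (q ^ a <= q ^ b) = (b <= a).
  by rewrite -(opprK a) -(opprK b) -!(exprz_inv q) ler_eXz2l ?lerN2// invf_gt1.
have qlt (a b : int) : (q ^ a < q ^ b) = (b < a) by rewrite !ltNge qle.
have -> : q * q ^ j = q ^ (1 + j) by rewrite expfzDr ?lt0r_neq0.
have jE : [set` `]-oo, q ^ j]] =
    [set` `]-oo, q ^ (1 + j)]] `|` [set` `]q ^ (1 + j), q ^ j]].
  by apply: itv_bndbnd_setU => //; rewrite bnd_simp qle; lia.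
rewrite !cdf_discrete_RV jE.
rewrite (@measureU _ _ _ (discrete_law (exprz q) w w0)); last 3 first.
- exact: measurable_itv.
- exact: measurable_itv.
- apply/seteqP; split => // z /=; rewrite !in_itv/= => -[zq /andP[qz _]].
  by have := le_lt_trans zq qz; rewrite ltxx.
rewrite fineD ?fin_num_measure//; [|exact: measurable_itv..].
rewrite addrAC subrr add0r -[RHS]/(fine (w j)%:E).
congr fine; apply: discrete_law1 => [|i] /=.
- by rewrite in_itv/= lexx qlt andbT; lia.
- by rewrite in_itv/= qle qlt; lia.
Qed.

(** * Sign and total integral of an arbitrary q-density *)

Lemma eseries_EFin {R : realType} (u : nat -> R) : cvgn (series u) ->
  (\sum_(0 <= j <oo) (u j)%:E)%E = (limn (series u))%:E.
Proof.
move=> cu; rewrite -EFin_lim//; congr (limn _).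
by apply/funext => n; rewrite /= sumEFin.
Qed.

Section q_density_theory.
Context {R : realType} {q : R} (q0 : 0 < q) (q1 : q < 1).
Context {d} {T : measurableType d} {P : probability T R} {X : {RV P >-> R}}.
Context {f : R -> R} (fX : q_density q X f).

Let F r := fine (cdf X r).
Let cdfE r : cdf X r = (F r)%:E.
Proof. by rewrite fineK ?fin_num_measure. Qed.

(** The Jackson sum at q x is the one at x without its term j = 0. *)
Lemma q_densityE x : 0 < x -> F x - F (q * x) = x * (1 - q) * f x.
Proof.
move=> x0; pose u y j := f (y * q ^+ j) * q ^+ j.
have qx0 : 0 < q * x by rewrite mulr_gt0.
have FE y : 0 < y ->
    cvgn (series (u y)) /\ F y = y * (1 - q) * limn (series (u y)).
  move=> /fX[cu]; rewrite /q_integral0 eseries_EFin// cdfE -EFinM.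
  by move=> [].
have [cx ->] := FE _ x0; have [cqx ->] := FE _ qx0.
suff -> : limn (series (u x)) = f x + q * limn (series (u (q * x))) by ring.
apply/cvg_lim => //; rewrite -cvg_shiftS.
rewrite (_ : (fun n => _) = (fun n => f x + q * series (u (q * x)) n)).
  by apply: cvgD; [exact: cvg_cst|exact: cvgMl_tmp].
apply/funext => n; rewrite !seriesEnat/= big_nat_recl//= mulr_sumr.
rewrite /u expr0 !mulr1; congr (_ + _); apply: eq_bigr => i _.
by rewrite exprS mulrA (mulrC q x) -!mulrA mulrCA.
Qed.

(** [q_density] does not assert the sign of [f]; by [q_densityE] it is that of an increment of the
    distribution function. *)
Lemma q_density_ge0 x : 0 < x -> 0 <= f x.
Proof.
move=> x0; rewrite -(@pmulr_rge0 _ (x * (1 - q))) ?mulr_gt0 ?subr_gt0//.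
rewrite -q_densityE// subr_ge0 fine_le ?fin_num_measure//.
by apply: cdf_nondecreasing; rewrite ler_piMl// ltW.
Qed.

(** The powers q^j with j >= 0 contribute F(1) by the definition of a q-density. The others
    telescope, by [q_densityE], to the limit of F(q^(-n)) - F(1), and F tends to 1 at infinity. *)
Lemma q_density_integral : q_integral0y q f = 1%E.
Proof.
have q1' : 1 - q != 0 by rewrite lt0r_neq0// subr_gt0.
have [cu] := fX _ ltr01; rewrite /q_integral0 cdfE mul1r => F1.
rewrite /q_integral0y.
have -> : (\sum_(1 <= j <oo) (f (q ^- j) * q ^- j)%:E =
    ((1 - F 1) / (1 - q))%:E)%E.
  apply/cvg_lim => //; rewrite -cvg_shiftS.
  have sE n : (\sum_(1 <= j < n.+1) (f (q ^- j) * q ^- j)%:E)%E =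
      ((F (q ^- n) - F 1) / (1 - q))%:E.
    rewrite sumEFin; congr EFin; elim: n => [|n ih].
      by rewrite big_geq// expr0 invr1 subrr mul0r.
    rewrite big_nat_recr//= ih.
    have qn : 0 < q ^- n.+1 by rewrite invr_gt0 exprn_gt0.
    have := q_densityE _ qn.
    have -> : q * q ^- n.+1 = q ^- n.
      by rewrite exprS invfM mulrA divff ?mul1r ?lt0r_neq0.
    move=> /eqP; rewrite subr_eq => /eqP ->; field.
    by rewrite q1' lt0r_neq0// exprn_gt0.
  rewrite (funext sE); apply: cvg_EFin; first by near=> n.
  apply: cvgMr_tmp; apply: cvgB; last exact: cvg_cst.
  have /cvge_pinftyP h := cvg_cdfy1 X.
  have /fine_cvg : cdf X (q ^- n) @[n --> \oo] --> 1%:E.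
    apply: h; apply/cvgrVy; first by near=> n; rewrite exprn_gt0.
    by apply: cvg_expr; rewrite gtr0_norm.
  exact.
have u1 : (fun j => f (1 * q ^+ j) * q ^+ j) = (fun j => f (q ^+ j) * q ^+ j).
  by apply/funext => j; rewrite mul1r.
move: cu F1; under eq_eseriesr do rewrite mul1r.
rewrite u1 => cu; rewrite eseries_EFin// -EFinM => -[->].
rewrite -EFinD -EFinM; congr EFin; field.
exact: q1'.
Unshelve. all: by end_near. Qed.

End q_density_theory.

(** * Perturbing a density without changing its q-moments *)

Lemma eseries_perturb {R : realType} (u h : nat -> R) (N : nat) (b : R) :
  (forall n, 0 <= u n) -> (\sum_(N <= n <oo) (u n)%:E)%E \is a fin_num ->
  \sum_(N <= n < M) h n @[M --> \oo] --> b ->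
  (\sum_(N <= n <oo) (u n + h n)%:E = \sum_(N <= n <oo) (u n)%:E + b%:E)%E.
Proof.
move=> u0 ufin cvh; apply/cvg_lim => //.
(* Since [h] may change sign, additivity of nonnegative series does not apply; partial sums are
   split before passing to the limit. *)
rewrite (_ : (fun M => _) = (fun M =>
    \sum_(N <= n < M) (u n)%:E + (\sum_(N <= n < M) h n)%:E)%E); last first.
  by apply/funext => M; rewrite !sumEFin big_split.
apply: cvgeD; first by rewrite fin_num_adde_defl.
  by apply: is_cvg_nneseries => n _ _; rewrite lee_fin.
by apply: cvg_EFin; [near=> n|exact: cvh].
Unshelve. all: by end_near. Qed.

(** The map j |-> q^j is injective, so [xget] recovers the exponent; off the powers of q its default
    0 is used. *)
Lemma exists_on_q_powers {R : realType} {q : R} (h : int -> R) :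
  0 < q -> q < 1 -> exists f : R -> R, forall j, f (q ^ j) = h j.
Proof.
move=> q0 q1; exists (fun x => h (xget 0 [set j | q ^ j = x])) => j.
congr h; case: xgetP => [i _ /= |/(_ j)]; last by rewrite /=.
by apply: ieexprIz; rewrite // lt_eqF.
Qed.

Section perturbation.
Context {R : realType} {q : R} (q0 : 0 < q) (q1 : q < 1).
Context {f h : R -> R} {e : R}.
Hypothesis f_ge0 : forall j : int, 0 <= f (q ^ j).
Hypothesis h0 : forall n : nat, h (q ^+ n.+1) = 0.
Hypothesis hE : forall n : nat, h (q ^- n) = e * (euler_coef q n * q ^+ n).

(** In the half j >= 0 only the point 1 sees [h], and it adds e. The other half gets e times the
    Euler series at q^(-k) without its term n = 0, which is -e because the full series vanishes. *)
Lemma q_moment_perturb k : q_moment q f k \is a fin_num ->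
  q_moment q (fun x => f x + h x) k = q_moment q f k.
Proof.
rewrite /q_moment /q_integral0y.
set A := (\sum_(0 <= _ <oo) _)%E; set B := (\sum_(1 <= _ <oo) _)%E => fin.
have h1 : h 1 = e by have := hE 0%N; rewrite euler_coef0 expr0 invr1 !mulr1.
have fp (n : nat) : 0 <= f (q ^+ n) by exact: (f_ge0 n).
have fn (n : nat) : 0 <= f (q ^- n) by rewrite exprnN.
(* Each half must be finite by itself, since the two are perturbed separately. *)
have /andP[Afin Bfin] : (A \is a fin_num) && (B \is a fin_num).
  rewrite -fin_numD.
  suff -> : (A + B = ((1 - q)^-1)%:E * ((1 - q)%:E * (A + B)))%E.
    exact: fin_numM.
  by rewrite muleA -EFinM mulVf ?mul1e// lt0r_neq0// subr_gt0.
have -> : (\sum_(0 <= j <oo)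
    ((q ^+ j) ^+ k * (f (q ^+ j) + h (q ^+ j)) * q ^+ j)%:E = A + e%:E)%E.
  under eq_eseriesr do rewrite mulrDr mulrDl.
  apply: eseries_perturb => //.
    by move=> n; rewrite !mulr_ge0 ?exprn_ge0 ?fp ?(ltW q0).
  rewrite -cvg_shiftS; apply: cvg_near_cst; near=> M.
  rewrite /= big_nat_recl//= expr0 h1 expr1n mul1r mulr1 big1 ?addr0// => i _.
  by rewrite h0 mulr0 mul0r.
have -> : (\sum_(1 <= j <oo)
    ((q ^- j) ^+ k * (f (q ^- j) + h (q ^- j)) * q ^- j)%:E = B + (- e)%:E)%E.
  under eq_eseriesr do rewrite mulrDr mulrDl.
  apply: eseries_perturb => //.
    move=> n.
    by rewrite !mulr_ge0 ?exprn_ge0 ?invr_ge0 ?exprn_ge0 ?fn ?(ltW q0).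
  rewrite -cvg_shiftS.
  (* The factor q^n in h(q^(-n)) cancels the weight q^(-n), leaving e a_n q^(-k n). *)
  have sE M : \sum_(1 <= n < M.+1) (q ^- n) ^+ k * h (q ^- n) * q ^- n =
    e * (\sum_(0 <= n < M.+1) euler_coef q n * (q ^- k) ^+ n) - e.
    rewrite [in RHS]big_ltn// euler_coef0 expr0 mulr1 mulrDr mulr1 addrAC subrr.
    rewrite add0r mulr_sumr; apply: eq_bigr => n _.
    have -> : (q ^- n) ^+ k = (q ^- k) ^+ n by rewrite !exprVn exprAC.
    by rewrite hE; field; rewrite expf_neq0 ?lt0r_neq0.
  rewrite (funext sE).
  suff cv : e * \sum_(0 <= n < M.+1) euler_coef q n * (q ^- k) ^+ n
      @[M --> \oo] --> e * 0.
    by have := cvgB cv (cvg_cst e); rewrite mulr0 sub0r; apply.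
  apply: cvgMl_tmp.
  rewrite (cvg_shiftS (fun M => \sum_(0 <= n < M) _)).
  exact: euler_sum0.
by rewrite addeACA -EFinD subrr adde0.
Unshelve. all: by end_near. Qed.

End perturbation.

Theorem theorem2p2 (R : realType) (q : R) (hq0 : 0 < q) (hq1 : q < 1)
  (d : measure_display) (T : measurableType d) (P : probability T R)
  (X : {RV P >-> R}) (f : R -> R)
  (hf : q_density q X f) (hmom : finite_q_moments q f)
  (hC : exists2 C : R, 0 < C &
    forall j : nat, C * q ^+ ((j * (j + 1)) %/ 2) <= f (q ^- j)) :
  q_moment_indeterminate q X.
Proof.
move=> /(_ f hf hmom) det; have [C C0 fC] := hC.
have f0 (j : int) : 0 <= f (q ^ j).
  by apply: (q_density_ge0 hq0 hq1 hf); rewrite exprz_gt0.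
have B0 : 0 < euler_bound q by rewrite expR_gt0.
(* With this e, |h(q^(-n))| <= e B q^(n(n-1)/2 + n) = C q^(n(n+1)/2) <= f(q^(-n)), where B is
   [euler_bound q]. *)
have [e e0 eE] : exists2 e, 0 < e & e * euler_bound q = C.
  by exists (C / euler_bound q); rewrite ?divr_gt0// divfK ?lt0r_neq0.
have [h hE] := exists_on_q_powers (fun j : int =>
  if j <= 0 then e * (euler_coef q `|j| * q ^+ `|j|) else 0) hq0 hq1.
have hN n : h (q ^- n) = e * (euler_coef q n * q ^+ n).
  by rewrite exprnN hE oppr_le0 abszN.
have hS n : h (q ^+ n.+1) = 0 by exact: (hE n.+1).
have h1 : h 1 = e by have := hN 0%N; rewrite euler_coef0 expr0 invr1 !mulr1.
have fh0 (j : int) : 0 <= f (q ^ j) + h (q ^ j).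
  case: (leP j 0) => j0; last first.
    by rewrite hE ifN -?ltNge// addr0.
  have -> : j = - `|j|%N%:Z by lia.
  set n := `|j|%N; rewrite -exprnN hN.
  have : `|e * (euler_coef q n * q ^+ n)| <= f (q ^- n).
    apply: le_trans (fC n); rewrite 2!normrM (gtr0_norm e0).
    rewrite (ger0_norm (exprn_ge0 n (ltW hq0))).
    have -> : ((n * (n + 1)) %/ 2 = 'C(n, 2) + n)%N.
      by have := bin2 n.+1; rewrite binS bin1 => ->; rewrite divn2 addn1 mulnC.
    apply: (@le_trans _ _ (e * (euler_bound q * q ^+ 'C(n, 2) * q ^+ n))).
      by rewrite ler_pM2l// ler_pM2r ?exprn_gt0//; exact: euler_coef_le.
    by rewrite exprD -eE !mulrA.
  by rewrite ler_norml => /andP[]; lra.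
have mom k : q_moment q (fun x => f x + h x) k = q_moment q f k.
  exact: (q_moment_perturb hq0 hq1 f0 hS hN).
(* The total mass is the q-moment of order 0. *)
have int1 : q_integral0y q (fun x => f x + h x) = 1%E.
  rewrite -(q_density_integral hq0 hq1 hf).
  by have := mom 0%N; rewrite /q_moment; under eq_fun do rewrite expr0 mul1r;
    under [in RHS]eq_fun do rewrite expr0 mul1r.
have [d' [T' [P' [Y [g [gY fg]]]]]] := exists_q_density hq0 hq1 fh0 int1.
(* Determinacy, read at the point q^0 = 1, would give f(1) = f(1) + e. *)
have /(_ 0) : q_equiv q f g.
  by apply: (det _ _ _ Y) => // k; rewrite -(eq_q_moment k fg) mom.
rewrite -fg expr0z h1 => /eqP.
by rewrite -subr_eq0 opprD addrA subrr add0r oppr_eq0 gt_eqF.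
Qed.
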